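(* Consider iterates $\{x^\nu\}$ generated by the homotopy algorithm with feasible initialization (described in the context), with $\epsilon^\nu\searrow0$, $\lambda^\nu\searrow0$ and $\sup_{\nu}\beta^\nu<1$. If $f$ is bounded from below, then: (i) any cluster point of $\{x^\nu\}$ is feasible; (ii) any cluster point of $\{x^\nu\}$ at which BCCQ is satisfied is C-stationary; (iii) any cluster point of $\{x^\nu\}$ is AM-stationary as long as $F_i$ is well-behaved for all $i\in\{1,\dots,p\}$; any such cluster point at which BCQ$^+$ is satisfied is actually M-stationary.
   Context: Setting: $f:\mathbb{R}^n\to\mathbb{R}$ and $G,H:\mathbb{R}^n\to\mathbb{R}^p$ are smooth, $C\subseteq\mathbb{R}^n$ is nonempty, closed and convex; the problem is to minimize $f(x)$ over $x\in C$ subject to $G(x)\ge0$, $H(x)\ge0$, $\langle G(x),H(x)\rangle=0$, and its solution set is assumed nonempty. $F_i=(G_i,H_i):\mathbb{R}^n\to\mathbb{R}^2$ with Jacobian $JF_i(x)\in\mathbb{R}^{2\times n}$ (rows $\nabla G_i(x)^\top,\nabla H_i(x)^\top$). $D=\{z\in\mathbb{R}^2:z_1,z_2\ge0,\ z_1z_2=0\}$; $x$ is feasible iff $x\in C$ and $F_i(x)\in D$ for all $i$. For $\beta\in(0,1)$, $$r_\beta(z)=\begin{cases}\frac{1}{2(1-\beta)}\|z\|^2&\text{if }z_1\le0,z_2\le0\\ \frac{(z_1+z_2)^2}{2\beta(2-\beta)}-\frac{\|z\|^2}{2\beta}&\text{if }(1-\beta)z_1\le z_2\le\frac{z_1}{1-\beta}\\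 \frac{1}{2(1-\beta)}\min\{z_1,z_2\}^2&\text{otherwise,}\end{cases}$$ which is continuously differentiable, and $s_{\lambda,\beta}(x)=f(x)+\frac1\lambda\sum_{i=1}^pr_\beta(F_i(x))$. Algorithm (feasible initialization): $x^0\in C$ satisfies $F_i(x^0)\in D$ for all $i$. For $\nu=1,2,\dots$, given $\epsilon^\nu,\lambda^\nu>0$ and $\beta^\nu\in(0,1)$, $x^\nu\in C$ is any point such that $s_{\lambda^\nu,\beta^\nu}(x^\nu)\le\min\{s_{\lambda^\nu,\beta^\nu}(x^{\nu-1}),f(x^0)\}$ and $\operatorname{dist}(-\nabla s_{\lambda^\nu,\beta^\nu}(x^\nu),N_C(x^\nu))\le\epsilon^\nu$. Here $N_C$ is the normal cone of the convex set $C$, and $a^\nu\searrow0$ means decreasing (nonincreasing) convergence to $0$. Cones at $z\in D$: $N_D(z)=\{0\}\times\mathbb{R}$ if $z_1>0$; $\mathbb{R}\times\{0\}$ if $z_2>0$; $N_D((0,0))=\{y:y_1\le0,y_2\le0\}\cup D$. $N_D^{\rm C}(z)=N_D(z)$ if $z\ne(0,0)$ and $N_D^{\rm C}((0,0))=N_D((0,0))\cup\mathbb{R}_+^2$. Stationarity: a feasible $x$ is M-stationary (resp. C-stationary) if there exist $y_i\in N_D(F_i(x))$ (resp. $y_i\in N_D^{\rm C}(F_i(x))$), $i=1,\dots,p$, with $0\in\nabla f(x)+\sum_{i=1}^pJF_i(x)^\top y_i+N_C(x)$. A feasible $x$ is AM-stationary if there exist sequences $x^\nu\in\mathbb{R}^n$,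 $y_i^\nu,z_i^\nu\in\mathbb{R}^2$ such that $\operatorname{dist}(-\nabla f(x^\nu)-\sum_iJF_i(x^\nu)^\top y_i^\nu,\,N_C(x^\nu))\to0$, $(x^\nu,z_i^\nu)\to(x,F_i(x))$, and $y_i^\nu\in N_D(z_i^\nu)$ (so $z_i^\nu\in D$) for all $i$ and $\nu$. Well-behaved: $F_i$ is well-behaved if there is $\xi>0$ such that for every $x\in\mathbb{R}^n$, $F_i(x)\notin\{z:\|z\|\le\xi,\ z_1>0,\ z_2>0\}$. Let $\mathcal W$ be the set of indices $i$ with $F_i$ well-behaved. BCCQ holds at a feasible $x$ if whenever $y_i=(y_i^G,y_i^H)\in\mathbb{R}^2$ satisfy $y_i\in N_D(F_i(x))$ for $i\in\mathcal W$, $y_i\in N_D^{\rm C}(F_i(x))$ for $i\notin\mathcal W$, and $0\in\sum_{i=1}^pJF_i(x)^\top y_i+N_C(x)$, then for each $i$: ($G_i$ is constant or $y_i^G=0$) and ($H_i$ is constant or $y_i^H=0$). BCQ$^+$ is the same condition with $y_i\in N_D(F_i(x))$ required for all $i\in\{1,\dots,p\}$. *)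

(* Defs.v *)
From HB Require Import structures.
From mathcomp Require Import all_boot all_order all_algebra.
From mathcomp Require Import all_classical all_reals all_analysis.
Import Order.TTheory GRing.Theory Num.Theory.
Import numFieldNormedType.Exports.

Set Implicit Arguments.
Unset Strict Implicit.
Unset Printing Implicit Defensive.

Local Open Scope classical_set_scope.
Local Open Scope ring_scope.

(* Vectors are row vectors, as in the differential calculus of MathComp
   Analysis: a product M^T y with a column vector y reads y *m M here.
   The library norm on 'rV[R]_n is the sup norm, hence [norm2] below; both
   norms induce the same topology. *)

Section Euclidean.
Variables (R : realType) (n : nat).

Definition dot (u v : 'rV[R]_n) : R := \sum_(j < n) u 0 j * v 0 j.

Definition norm2 (u : 'rV[R]_n) : R := Num.sqrt (dot u u).

(* Extended-real valued, so that the distance to the empty set is +oo; this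
   matters for normal cones at points outside the set. *)
Definition dist (u : 'rV[R]_n) (A : set 'rV[R]_n) : \bar R :=
  ereal_inf [set (norm2 (u - v))%:E | v in A].

Definition normal_cone (C : set 'rV[R]_n) (x : 'rV[R]_n) : set 'rV[R]_n :=
  [set v | C x /\ forall c, C c -> dot v (c - x) <= 0].

Definition grad (g : 'rV[R]_n -> R) (x : 'rV[R]_n) : 'rV[R]_n :=
  \row_(j < n) 'D_(delta_mx 0 j) g x.

(* Smoothness is continuous differentiability. *)
Definition smooth (g : 'rV[R]_n -> R) : Prop :=
  (forall x, differentiable g x) /\ continuous (grad g).

Definition is_constant (g : 'rV[R]_n -> R) : Prop :=
  exists c, forall x, g x = c.

End Euclidean.

Section Complementarity.
Variable R : realType.
Implicit Types z : 'rV[R]_2.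

Local Notation "z '_1'" := (z 0 0) (at level 2, format "z '_1'").
Local Notation "z '_2'" := (z 0 1) (at level 2, format "z '_2'").

Definition setD2 : set 'rV[R]_2 := [set z | [/\ 0 <= z _1, 0 <= z _2 & z _1 * z _2 = 0]].

(* Empty at z outside [setD2], like every normal cone. *)
Definition ND z : set 'rV[R]_2 :=
  [set y : 'rV[R]_2 | setD2 z /\
    (if 0 < z _1 then y _1 = 0
     else if 0 < z _2 then y _2 = 0
     else (y _1 <= 0 /\ y _2 <= 0) \/ setD2 y)].

Definition NDC z : set 'rV[R]_2 :=
  [set y : 'rV[R]_2 | ND z y \/ [/\ z = 0, 0 <= y _1 & 0 <= y _2]].

Definition r_beta (beta : R) z : R :=
  if (z _1 <= 0) && (z _2 <= 0) then
    (2 * (1 - beta))^-1 * norm2 z ^+ 2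
  else if (1 - beta) * z _1 <= z _2 <= z _1 / (1 - beta) then
    (z _1 + z _2) ^+ 2 / (2 * beta * (2 - beta)) - norm2 z ^+ 2 / (2 * beta)
  else (2 * (1 - beta))^-1 * Num.min z _1 z _2 ^+ 2.

Definition well_behaved (n : nat) (Fi : 'rV[R]_n -> 'rV[R]_2) : Prop :=
  exists2 xi, 0 < xi &
    forall x, ~ [/\ norm2 (Fi x) <= xi, 0 < (Fi x) _1 & 0 < (Fi x) _2].

End Complementarity.

Section MPCC.
Variables (R : realType) (n p : nat).
Variables (f : 'rV[R]_n -> R) (G H : 'rV[R]_n -> 'rV[R]_p) (C : set 'rV[R]_n).
Implicit Types (x : 'rV[R]_n) (y : 'I_p -> 'rV[R]_2) (i : 'I_p).

Definition Gi i x : R := G x 0 i.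
Definition Hi i x : R := H x 0 i.

Definition Fi i x : 'rV[R]_2 := \row_(k < 2) if k == 0 then Gi i x else Hi i x.

(* ['J] is the matrix acting on row vectors from the right, that is, the
   transpose of the usual Jacobian. *)
Definition JF i x : 'M[R]_(2, n) := ('J (Fi i) x)^T.

Definition feasible x : Prop := C x /\ forall i, setD2 (Fi i x).

Definition solution_set : set 'rV[R]_n :=
  [set x | feasible x /\ forall u, feasible u -> f x <= f u].

Definition s_fun (lambda beta : R) x : R :=
  f x + lambda^-1 * \sum_(i < p) r_beta beta (Fi i x).

(* The parameters of step k are [eps k], [lam k], [beta k] for k >= 1; their
   values at 0 play no role. *)
Definition homotopy_iterates (eps lam beta : nat -> R) (x : nat -> 'rV[R]_n) :
    Prop :=
  [/\ forall k, (0 < k)%N -> [/\ 0 < eps k, 0 < lam k & 0 < beta k < 1],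
      feasible (x 0%N)
    & forall k, (0 < k)%N ->
        [/\ C (x k),
            s_fun (lam k) (beta k) (x k)
              <= Num.min (s_fun (lam k) (beta k) (x k.-1)) (f (x 0%N))
          & (dist (- grad (s_fun (lam k) (beta k)) (x k))
                  (normal_cone C (x k)) <= (eps k)%:E)%E]].

Definition M_stationary x : Prop :=
  feasible x /\ exists y,
    (forall i, ND (Fi i x) (y i)) /\
    exists2 v, normal_cone C x v &
      grad f x + \sum_(i < p) y i *m JF i x + v = 0.

Definition C_stationary x : Prop :=
  feasible x /\ exists y,
    (forall i, NDC (Fi i x) (y i)) /\
    exists2 v, normal_cone C x v &
      grad f x + \sum_(i < p) y i *m JF i x + v = 0.

Definition AM_stationary x : Prop :=
  feasible x /\
  exists (xs : nat -> 'rV[R]_n) (ys zs : nat -> 'I_p -> 'rV[R]_2),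
    [/\ (fun k => dist (- grad f (xs k) - \sum_(i < p) ys k i *m JF i (xs k))
                       (normal_cone C (xs k))) @ \oo --> 0%E,
        xs @ \oo --> x,
        forall i, (fun k => zs k i) @ \oo --> Fi i x
      & forall k i, ND (zs k i) (ys k i)].

(* The common conclusion of the two qualification conditions. *)
Definition multiplier_trivial y : Prop :=
  forall i, (is_constant (Gi i) \/ y i 0 0 = 0) /\
            (is_constant (Hi i) \/ y i 0 1 = 0).

Definition BCCQ x : Prop :=
  forall y,
    (forall i, well_behaved (Fi i) -> ND (Fi i x) (y i)) ->
    (forall i, ~ well_behaved (Fi i) -> NDC (Fi i x) (y i)) ->
    (exists2 v, normal_cone C x v & \sum_(i < p) y i *m JF i x + v = 0) ->
    multiplier_trivial y.

Definition BCQplus x : Prop :=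
  forall y,
    (forall i, ND (Fi i x) (y i)) ->
    (exists2 v, normal_cone C x v & \sum_(i < p) y i *m JF i x + v = 0) ->
    multiplier_trivial y.

End MPCC.

Lemma JF_rows (R : realType) (n p : nat) (G H : 'rV[R]_n -> 'rV[R]_p) i x :
  differentiable (Gi G i) x -> differentiable (Hi H i) x ->
  JF G H i x =
  \matrix_(k < 2) if k == 0 then grad (Gi G i) x else grad (Hi H i) x.
Proof.
move=> dG dH.
have dF : differentiable (Fi G H i) x.
  have -> : Fi G H i = (fun u => Gi G i u *: (delta_mx 0 0 : 'rV[R]_2))
                        \+ (fun u => Hi H i u *: (delta_mx 0 1 : 'rV[R]_2)).
    apply/funext => u; apply/rowP => -[[|[|//]] k2]; rewrite !mxE /=;
      by rewrite ?mulr1 ?mulr0 ?addr0 ?add0r.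
  by apply: differentiableD; apply: differentiableZl.
apply/matrixP => k j.
have -> : JF G H i x k j = ('J (Fi G H i) x) j k by rewrite [LHS]mxE.
have -> : ('J (Fi G H i) x) j k = ('D_(delta_mx 0 j) (Fi G H i) x) 0 k.
  by rewrite deriveEjacobian// -rowE [RHS]mxE.
rewrite derive_mx ?mxE; last exact: diff_derivable.
case: ifP => k0; rewrite mxE; congr (derive _ _ _); apply/funext => u;
  by rewrite mxE k0.
Qed.

(* Main.v *)
Require Import Defs.
From HB Require Import structures.
From mathcomp Require Import all_boot all_order all_algebra.
From mathcomp Require Import all_classical all_reals all_analysis.
From mathcomp Require Import ring lra.
Import Order.TTheory GRing.Theory Num.Theory.
Import numFieldNormedType.Exports.
Local Open Scope classical_set_scope.
Local Open Scope ring_scope.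

(* r_beta is C^1 and piecewise quadratic, so the gradient of the penalized
   objective has the form grad f + sum_i JF_i^T y_i, where y_i is the gradient
   of r_beta at F_i, divided by lambda. Feasibility of cluster points follows
   from r_beta(z) >= min(z_1, z_2)^2 / 2 and s(x^k) <= f(x^0). The multipliers
   y_i always have two coordinates of the same sign, vanish in the direction of
   a coordinate of F_i that stays positive (here sup beta < 1 is used), and are
   nonpositive when F_i is well-behaved and tends to 0; so they eventually lie in
   the limiting cone at the cluster point itself. This gives AM-stationarity
   with the constant sequence z_i = F_i(xbar). Under a qualification condition
   the multipliers are bounded, up to those of constant components, and a limit
   exists along an ultrafilter. *)

Set Implicit Arguments.
Unset Strict Implicit.
Unset Printing Implicit Defensive.

(** * The penalty [r_beta] and its gradient, piece by piece *)

Section PiecewiseQuadratic.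
Variable R : realType.
Implicit Types (b : R) (k l : bool * bool) (z : 'rV[R]_2).

(* [r_beta b] is a quadratic form on each of four closed cones covering the
   plane. The two booleans tell which coordinates of [z] enter the form, except
   that [(false, false)] stands for the middle cone. *)
Definition piece b k z : bool :=
  match k with
  | (true, true) => (z 0 0 <= 0) && (z 0 1 <= 0)
  | (false, false) =>
      ((1 - b) * z 0 0 <= z 0 1) && ((1 - b) * z 0 1 <= z 0 0)
  | (true, false) => (0 <= z 0 1) && (z 0 0 <= (1 - b) * z 0 1)
  | (false, true) => (0 <= z 0 0) && (z 0 1 <= (1 - b) * z 0 0)
  end.

(** Coefficients of the squares and of the mixed product in the order used by [quad]. On the outer
    cones the booleans, read as 0 or 1, switch the two squares on and off; the middle triple comes
    from expanding the second branch of [r_beta]. *)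
Definition piece_coef b k : R * R * R :=
  match k with
  | (false, false) => ((b - 1) / (2 * b * (2 - b)), (b * (2 - b))^-1,
                       (b - 1) / (2 * b * (2 - b)))
  | (c, d) => ((2 * (1 - b))^-1 *+ c, 0, (2 * (1 - b))^-1 *+ d)
  end.

Definition quad (a : R * R * R) z : R :=
  a.1.1 * z 0 0 ^+ 2 + a.1.2 * (z 0 0 * z 0 1) + a.2 * z 0 1 ^+ 2.

Definition dquad (a : R * R * R) z : 'rV[R]_2 :=
  \row_(j < 2) if j == 0 then 2 * a.1.1 * z 0 0 + a.1.2 * z 0 1
               else a.1.2 * z 0 0 + 2 * a.2 * z 0 1.

Lemma sqr_norm2E z : norm2 z ^+ 2 = z 0 0 ^+ 2 + z 0 1 ^+ 2.
Proof.
rewrite sqr_sqrtr.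
  rewrite /dot big_ord_recl big_ord1 !expr2.
  by congr (_ + z 0 _ * z 0 _); apply: val_inj.
by apply: sumr_ge0 => j _; rewrite -expr2 sqr_ge0.
Qed.

Lemma piece_exists b z : 0 < b < 1 -> exists k, piece b k z.
Proof.
move=> /andP[b0 b1].
set s := z 0 0; set t := z 0 1.
have [H|/negP H] := boolP (piece b (true, true) z); first by exists (true, true).
have [H'|/negP H'] := boolP (piece b (false, false) z); first by exists (false, false).
have [H2|/negP H2] := boolP (piece b (true, false) z); first by exists (true, false).
exists (false, true) => /=; rewrite -/s -/t in H H' H2 *.
have [s0|s0] := leP 0 s; have [t1|t1] := leP t ((1 - b) * s) => //=.
- case: H'; rewrite /= -/s -/t ltW //=.
  rewrite leNgt; apply/negP => st; case: H2; rewrite /= -/s -/t; apply/andP; split; nra.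
- case: H; rewrite /= -/s -/t; apply/andP; split; nra.
- case: H; rewrite /= -/s -/t; apply/andP; split; first lra.
  rewrite leNgt; apply/negP => t0; case: H2; rewrite /= -/s -/t; apply/andP; split; nra.
Qed.

(** The closed cones overlap along boundary rays, where an earlier branch of [r_beta] may be the
    active one. There a coordinate vanishes or one coordinate is [1 - b] times the other, and the
    two forms agree. *)
Lemma r_beta_piece b k z : 0 < b < 1 -> piece b k z ->
  r_beta b z = quad (piece_coef b k) z.
Proof.
move=> /andP[b0 b1]; rewrite /r_beta /quad !sqr_norm2E.
set s := z 0 0; set t := z 0 1.
have b1' : 0 < 1 - b by rewrite subr_gt0.
rewrite ler_pdivlMr // [t * _]mulrC.
have b_neq0 : b != 0 by rewrite gt_eqF.
have b1_neq0 : 1 - b != 0 by rewrite gt_eqF.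
have b2_neq0 : 2 - b != 0 by rewrite gt_eqF // subr_gt0; lra.
case: k => -[] [] /=; rewrite -/s -/t ?mulr1n ?mulr0n => /andP[h1 h2].
- by rewrite h1 h2 /=; ring.
- case: ifP => [/andP[s0 t0]|_].
    have -> : t = 0 by lra.
    by ring.
  case: ifP => [/andP[h3 h4]|_].
    have -> : s = (1 - b) * t by nra.
    by field; do ?[apply/andP; split].
  by rewrite min_l; [ring|nra].
- case: ifP => [/andP[s0 t0]|_].
    have -> : s = 0 by lra.
    by ring.
  case: ifP => [/andP[h3 h4]|_].
    have -> : t = (1 - b) * s by nra.
    by field; do ?[apply/andP; split].
  by rewrite min_r; [ring|nra].
- case: ifP => [/andP[s0 t0]|_].
    have -> : t = 0 by nra.
    have -> : s = 0 by nra.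
    by ring.
  by rewrite h1 h2 /=; field; do ?[apply/andP; split].
Qed.

(** This is the C^1 gluing of the pieces. Distinct cones meet only at the origin or on a ray where a
    coordinate is 0 or [1 - b] times the other; substituting this relation makes the gradients
    coincide. *)
Lemma dquad_piece_unique b k l z : 0 < b < 1 -> piece b k z -> piece b l z ->
  dquad (piece_coef b k) z = dquad (piece_coef b l) z.
Proof.
move=> /andP[b0 b1].
set s := z 0 0; set t := z 0 1.
have b1' : 0 < 1 - b by rewrite subr_gt0.
have b_neq0 : b != 0 by rewrite gt_eqF.
have b1_neq0 : 1 - b != 0 by rewrite gt_eqF.
have b2_neq0 : 2 - b != 0 by rewrite gt_eqF // subr_gt0; lra.
suff H k' l' : piece b k' z -> piece b l' z ->
    (2 * (piece_coef b k').1.1 * s + (piece_coef b k').1.2 * t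
      = 2 * (piece_coef b l').1.1 * s + (piece_coef b l').1.2 * t) /\
    ((piece_coef b k').1.2 * s + 2 * (piece_coef b k').2 * t
      = (piece_coef b l').1.2 * s + 2 * (piece_coef b l').2 * t).
  move=> hk hl; have [h1 h2] := H _ _ hk hl.
  by apply/rowP => j; rewrite !mxE; case: ifP.
case: k' l' => -[] [] [] [] [] //=; rewrite -/s -/t ?mulr1n ?mulr0n;
  move=> /andP[h1 h2] /andP[h3 h4];
  try (have s0 : s = 0 by nra); try (have t0 : t = 0 by nra); rewrite ?s0 ?t0;
  try (split; ring);
  (have e : s = (1 - b) * t by lra) || (have e : t = (1 - b) * s by lra);
  by rewrite e; split; field; do ?[apply/andP; split].
Qed.

(** The gradient of [r_beta b], read off from an arbitrary piece containing [z]; for [0 < b < 1]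
    such a piece exists and its choice does not affect the value. *)
Definition rgrad b z : 'rV[R]_2 :=
  dquad (piece_coef b (odflt (true, true) [pick k | piece b k z])) z.

Lemma rgradE b k z : 0 < b < 1 -> piece b k z ->
  rgrad b z = dquad (piece_coef b k) z.
Proof.
move=> b01 zk; rewrite /rgrad; case: pickP => [l zl|/(_ k)]; last by rewrite zk.
exact: dquad_piece_unique.
Qed.

(** On the outer cones the factor [(1 - b)^-1] is at least 1, so only the middle cone requires a
    real estimate. The bound is uniform in [b], which lets it pass to the limit along the
    iterates. *)
Lemma le_sqr_min_r_beta b z : 0 < b < 1 ->
  Num.min (z 0 0) (z 0 1) ^+ 2 <= 2 * r_beta b z.
Proof.
move=> b01; have [k zk] := piece_exists z b01.
rewrite (r_beta_piece b01 zk); move: zk; have /andP[b0 b1] := b01.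
rewrite /quad.
set s := z 0 0; set t := z 0 1.
have b1' : 0 < 1 - b by rewrite subr_gt0.
have b2' : 0 < 2 - b by lra.
have c1 : 1 <= (1 - b)^-1 by rewrite -invr1 lef_pV2 ?posrE; lra.
have cE : 2 * (2 * (1 - b))^-1 = (1 - b)^-1 by field; rewrite gt_eqF.
have sqm : Num.min s t ^+ 2 <= (1 - b)^-1 * Num.min s t ^+ 2.
  by rewrite ler_peMl ?sqr_ge0.
have i0 : 0 < (1 - b)^-1 by rewrite invr_gt0.
case: k => -[] [] /=; rewrite -/s -/t ?mulr1n ?mulr0n => /andP[h1 h2].
- rewrite mul0r addr0 -mulrDr mulrA cE (le_trans sqm) // ler_pM2l //.
  by case: (leP s t) => _; rewrite ?(lerDl, lerDr) sqr_ge0.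
- by rewrite !mul0r !addr0 mulrA cE; move: sqm; rewrite min_l //; nra.
- by rewrite !mul0r !add0r mulrA cE; move: sqm; rewrite min_r //; nra.
set q := _ + _.
have -> : 2 * q = ((2 * s * t) - (1 - b) * (s ^+ 2 + t ^+ 2)) / (b * (2 - b)).
  by rewrite /q; field; rewrite !gt_eqF.
rewrite ler_pdivlMr ?mulr_gt0 //.
(* The right side minus the left side equals [b * u * (v - u) + (v - u) * (u - (1 - b) * v) + (b *
   u) ^+ 2], a sum of nonnegative terms. *)
have key (u v : R) : (1 - b) * v <= u -> u <= v ->
    u ^+ 2 * (b * (2 - b)) <= 2 * u * v - (1 - b) * (u ^+ 2 + v ^+ 2).
  move=> vu uv; have u0 : 0 <= u by nra.
  have := mulr_ge0 (mulr_ge0 (ltW b0) u0) (_ : 0 <= v - u); rewrite subr_ge0 => /(_ uv).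
  have := mulr_ge0 (_ : 0 <= v - u) (_ : 0 <= u - (1 - b) * v).
  by rewrite !subr_ge0 => /(_ uv vu); have := sqr_ge0 (b * u); nra.
have [st|/ltW ts] := leP s t; first exact: key.
by have := key _ _ h1 ts; rewrite [2 * t * s]mulrAC [t ^+ 2 + _]addrC.
Qed.

Lemma r_beta_ge0 b z : 0 < b < 1 -> 0 <= r_beta b z.
Proof.
move=> /(le_sqr_min_r_beta z).
by have := sqr_ge0 (Num.min (z 0 0) (z 0 1)); lra.
Qed.

(** On the two cones with a single square one entry is 0, and on the nonpositive quadrant the
    gradient is a positive multiple of [z]. On the middle cone the entries are positive multiples of
    the two differences that define the cone. *)
Lemma rgrad_same_sign b z : 0 < b < 1 ->
  (rgrad b z 0 0 <= 0 /\ rgrad b z 0 1 <= 0) \/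
  (0 <= rgrad b z 0 0 /\ 0 <= rgrad b z 0 1).
Proof.
move=> b01; have [k zk] := piece_exists z b01.
rewrite (rgradE b01 zk) !mxE /=; move: zk; have /andP[b0 b1] := b01.
set s := z 0 0; set t := z 0 1.
have b1' : 0 < 1 - b by rewrite subr_gt0.
have b2' : 0 < 2 - b by lra.
have cE : 2 * (2 * (1 - b))^-1 = (1 - b)^-1 by field; rewrite gt_eqF.
have i0 : 0 < (1 - b)^-1 by rewrite invr_gt0.
case: k => -[] [] /=; rewrite -/s -/t ?mulr1n ?mulr0n ?mul0r ?mulr0 ?mul0r;
  rewrite ?addr0 ?add0r ?cE => /andP[h1 h2].
- by left; split; nra.
- by have [s0|s0] := leP s 0; [left|right]; split; nra.
- by have [s0|s0] := leP t 0; [left|right]; split; nra.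
have d0 : 0 < (b * (2 - b))^-1 by rewrite invr_gt0 mulr_gt0.
right; split.
- have -> : 2 * ((b - 1) / (2 * b * (2 - b))) * s + (b * (2 - b))^-1 * t
    = (b * (2 - b))^-1 * (t - (1 - b) * s) by field; rewrite !gt_eqF.
  by apply: mulr_ge0; [exact: ltW|rewrite subr_ge0].
- have -> : (b * (2 - b))^-1 * s + 2 * ((b - 1) / (2 * b * (2 - b))) * t
    = (b * (2 - b))^-1 * (s - (1 - b) * t) by field; rewrite !gt_eqF.
  by apply: mulr_ge0; [exact: ltW|rewrite subr_ge0].
Qed.

(** On this cone [r_beta b] depends on the second coordinate alone. *)
Lemma rgrad_fst_eq0 b z : 0 < b < 1 -> 0 <= z 0 0 -> z 0 1 <= (1 - b) * z 0 0 ->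
  rgrad b z 0 0 = 0.
Proof.
move=> b01 h1 h2; rewrite (@rgradE b (false, true)) ?mxE //= ?h1 //.
by rewrite mulr0n; ring.
Qed.

Lemma rgrad_snd_eq0 b z : 0 < b < 1 -> 0 <= z 0 1 -> z 0 0 <= (1 - b) * z 0 1 ->
  rgrad b z 0 1 = 0.
Proof.
move=> b01 h1 h2; rewrite (@rgradE b (true, false)) ?mxE //= ?h1 //.
by rewrite mulr0n; ring.
Qed.

Lemma rgrad_le0 b z : 0 < b < 1 -> ~ (0 < z 0 0 /\ 0 < z 0 1) ->
  rgrad b z 0 0 <= 0 /\ rgrad b z 0 1 <= 0.
Proof.
move=> b01 npos; have [k zk] := piece_exists z b01.
rewrite (rgradE b01 zk) !mxE /=; move: zk; have /andP[b0 b1] := b01.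
move: npos; set s := z 0 0; set t := z 0 1 => npos.
have {npos} npos : s <= 0 \/ t <= 0.
  have [?|s0] := leP s 0; [by left|right].
  by rewrite leNgt; apply/negP => t0; apply: npos.
have b1' : 0 < 1 - b by rewrite subr_gt0.
have b2' : 0 < 2 - b by lra.
have cE : 2 * (2 * (1 - b))^-1 = (1 - b)^-1 by field; rewrite gt_eqF.
have i0 : 0 < (1 - b)^-1 by rewrite invr_gt0.
case: k => -[] [] /=; rewrite -/s -/t ?mulr1n ?mulr0n ?mul0r ?mulr0 ?mul0r;
  rewrite ?addr0 ?add0r ?cE => /andP[h1 h2].
- by split; nra.
- have s0 : s <= 0 by case: npos => ?; nra.
  by split => //; nra.
- have t0 : t <= 0 by case: npos => ?; nra.
  by split => //; nra.
have b2b : 0 < b * (2 - b) by rewrite mulr_gt0.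
(* Chaining the inequalities of the middle cone gives [(1 - b) ^+ 2 * s <= s], and
   [1 - (1 - b) ^+ 2 = b * (2 - b)]. The middle cone thus lies in the nonnegative quadrant, and
   without two positive coordinates only the origin remains. *)
have s0 : 0 <= s by rewrite -(pmulr_rge0 _ b2b); nra.
have t0 : 0 <= t by rewrite -(pmulr_rge0 _ b2b); nra.
have {s0 t0} [-> ->] : s = 0 /\ t = 0 by case: npos => ?; split; nra.
by rewrite !mulr0 addr0.
Qed.
End PiecewiseQuadratic.

(** * Derivatives of functions glued from finitely many pieces *)

(** The active piece may change along the line through [x]. Since there are finitely many pieces,
    all their difference quotients are simultaneously close to [l], hence so is the quotient of
    [phi], whichever piece is active. *)
Lemma is_derive_pieces (R : realType) (V : normedModType R) (T : finType)
    (good : pred T) (q : T -> V -> R) (phi : V -> R) (x v : V) (l : R) :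
  (\forall w \near x, exists2 k, good k & phi w = q k w) ->
  (forall k, good k -> phi x = q k x /\ is_derive x v (q k) l) ->
  is_derive x v phi l.
Proof.
move=> phiE qx.
suff cv : h^-1 *: ((phi \o shift x) (h *: v) - phi x) @[h --> 0^'] --> l.
  by apply: DeriveDef; [exact: cvgP cv|exact: cvg_lim cv].
have line_cvg : h *: v + x @[h --> (0 : R)^'] --> x.
  have cv : h *: v + x @[h --> (0 : R)] --> x.
    rewrite -[in X in _ --> X](add0r x) -(scale0r v).
    by apply: cvgD; [exact: (@scalel_continuous R V v 0)|exact: cvg_cst].
  by move=> A /cv; exact: nbhs_dnbhs.
move=> A lA.
have quotA : \forall h \near (0 : R)^', forall k, good k ->
    A (h^-1 *: ((q k \o shift x) (h *: v) - q k x)).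
  apply: filter_forall => k.
  have [gk|ngk] := boolP (good k); last by near=> h.
  have [_ [dq ql]] := qx k gk.
  have : h^-1 *: ((q k \o shift x) (h *: v) - q k x) @[h --> 0^'] --> l.
    by rewrite -ql; exact: dq.
  by move=> /(_ A lA) qA; near=> h => _; near: h; exact: qA.
have {phiE} := line_cvg _ phiE; apply: filterS2 quotA => h qA [k gk e] /=.
by rewrite /= /shift e (qx k gk).1; exact: qA.
Unshelve. all: by end_near. Qed.

Lemma closed_halfplane (R : realType) (c d : R) :
  closed [set z : 'rV[R]_2 | 0 <= c * z 0 0 + d * z 0 1].
Proof.
apply: (@closed_comp _ _ (fun z : 'rV[R]_2 => c * z 0 0 + d * z 0 1)
  [set s | 0 <= s]); last exact: closed_ge.
move=> z _; exact: (cvgD (cvgM (cvg_cst c) (@coord_continuous R 1 2 0 0 z))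
  (cvgM (cvg_cst d) (@coord_continuous R 1 2 0 1 z))).
Qed.

Lemma closed_piece (R : realType) (b : R) k : closed [set z | piece b k z].
Proof.
have eq_cl (A B : set 'rV[R]_2) : A = B -> closed A -> closed B by move=> ->.
have cl (c d c' d' : R) : closed [set z : 'rV[R]_2 |
    (0 <= c * z 0 0 + d * z 0 1) && (0 <= c' * z 0 0 + d' * z 0 1)].
  apply: eq_cl (closedI (@closed_halfplane R c d) (@closed_halfplane R c' d')).
  by apply/seteqP; split => z /= /andP.
case: k => -[] [].
- apply: eq_cl (cl (-1) 0 0 (-1)); apply/funext => z /=; congr is_true.
  by congr andb; apply/idP/idP; lra.
- apply: eq_cl (cl 0 1 (-1) (1 - b)); apply/funext => z /=; congr is_true.
  by congr andb; apply/idP/idP; lra.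
- apply: eq_cl (cl 1 0 (1 - b) (-1)); apply/funext => z /=; congr is_true.
  by congr andb; apply/idP/idP; lra.
- apply: eq_cl (cl (- (1 - b)) 1 1 (- (1 - b))); apply/funext => z /=; congr is_true.
  by congr andb; apply/idP/idP; lra.
Qed.

(** * The gradient of the penalized objective *)

Section PenaltyGradient.
Variables (R : realType) (n p : nat).
Variables (f : 'rV[R]_n -> R) (G H : 'rV[R]_n -> 'rV[R]_p).
Implicit Types (x v : 'rV[R]_n) (i : 'I_p).

Lemma is_derive_quad (a : R * R * R) i x v (dg dh : R) :
  is_derive x v (Gi G i) dg -> is_derive x v (Hi H i) dh ->
  is_derive x v (quad a \o Fi G H i)
    (dquad a (Fi G H i x) 0 0 * dg + dquad a (Fi G H i x) 0 1 * dh).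
Proof.
move=> Dg Dh.
rewrite (_ : _ \o _ = a.1.1 *: (Gi G i * Gi G i) + a.1.2 *: (Gi G i * Hi H i)
                      + a.2 *: (Hi H i * Hi H i)).
  have D := is_deriveD (is_deriveD (is_deriveZ a.1.1 (is_deriveM Dg Dg))
    (is_deriveZ a.1.2 (is_deriveM Dg Dh))) (is_deriveZ a.2 (is_deriveM Dh Dh)).
  apply: (@is_derive_eq _ _ _ _ _ _ _ _ D); rewrite !mxE /= /GRing.scale /=.
  by move: (Gi G i x) (Hi H i x) => s t; ring.
by apply/funext => w; rewrite /quad /= !mxE.
Qed.

Lemma is_derive_r_beta b i x v (dg dh : R) : 0 < b < 1 ->
  differentiable (Gi G i) x -> differentiable (Hi H i) x ->
  is_derive x v (Gi G i) dg -> is_derive x v (Hi H i) dh ->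
  is_derive x v (r_beta b \o Fi G H i)
    (rgrad b (Fi G H i x) 0 0 * dg + rgrad b (Fi G H i x) 0 1 * dh).
Proof.
move=> b01 cg ch Dg Dh.
apply: (@is_derive_pieces _ _ _ [pred k | piece b k (Fi G H i x)]
  (fun k => quad (piece_coef b k) \o Fi G H i)) => [|k /= xk]; last first.
  by rewrite (rgradE b01 xk) (r_beta_piece b01 xk); split => //; exact: is_derive_quad.
have Fc : {for x, continuous (Fi G H i)}.
  rewrite (_ : Fi G H i = (fun u => Gi G i u *: (delta_mx 0 0 : 'rV[R]_2))
                        \+ (fun u => Hi H i u *: (delta_mx 0 1 : 'rV[R]_2))).
    by apply: differentiable_continuous; apply: differentiableD; exact: differentiableZl.
  apply/funext => u; apply/rowP => -[[|[|//]] k2]; rewrite !mxE /=;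
    by rewrite ?mulr1 ?mulr0 ?addr0 ?add0r.
(* The finitely many pieces that miss [Fi G H i x] are closed, so by continuity they are also missed
   near [x]. *)
have : \forall w \near x, forall k, piece b k (Fi G H i w) -> piece b k (Fi G H i x).
  apply: (@filter_forall _ _ _ (nbhs x)) => k.
  have [xk|/negP xk] := boolP (piece b k (Fi G H i x)); first by near=> w.
  have : \forall w \near Fi G H i x, ~ piece b k w.
    by apply: open_nbhs_nbhs; split => //; apply: closed_openC; exact: closed_piece.
  by move=> /Fc nk; near=> w => xw; exfalso; move: xw; near: w.
move=> good; near=> w.
have [k wk] := piece_exists (Fi G H i w) b01.
exists k; last exact: r_beta_piece.
by move: k wk; near: w.
Unshelve. all: by end_near. Qed.

(** The Jacobian term of the stationarity conditions, written with gradients so that limits involve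
    no matrices. *)
Definition mult_grad (y : 'I_p -> 'rV[R]_2) x : 'rV[R]_n :=
  \sum_(i < p) (y i 0 0 *: grad (Gi G i) x + y i 0 1 *: grad (Hi H i) x).

Lemma sum_JFE y x :
  (forall i, differentiable (Gi G i) x) -> (forall i, differentiable (Hi H i) x) ->
  \sum_(i < p) y i *m JF G H i x = mult_grad y x.
Proof.
move=> dG dH; apply: eq_bigr => i _; rewrite JF_rows //.
apply/rowP => j; rewrite !mxE big_ord_recl big_ord1 !mxE /=.
by congr (y i 0 _ * _ + y i 0 _ * _); apply: val_inj.
Qed.

Lemma grad_s_fun (lambda b : R) x : 0 < b < 1 ->
  differentiable f x ->
  (forall i, differentiable (Gi G i) x) -> (forall i, differentiable (Hi H i) x) ->
  grad (s_fun f G H lambda b) x =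
  grad f x + mult_grad (fun i => lambda^-1 *: rgrad b (Fi G H i x)) x.
Proof.
move=> b01 df dG dH; apply/rowP => j; rewrite !mxE summxE.
have Ds : is_derive x (delta_mx 0 j) (s_fun f G H lambda b)
    ('D_(delta_mx 0 j) f x + lambda^-1 *: \sum_(i < p)
      (rgrad b (Fi G H i x) 0 0 * 'D_(delta_mx 0 j) (Gi G i) x
       + rgrad b (Fi G H i x) 0 1 * 'D_(delta_mx 0 j) (Hi H i) x)).
  rewrite (_ : s_fun f G H lambda b =
      f + lambda^-1 *: \sum_(i < p) (r_beta b \o Fi G H i)); last first.
    by apply/funext => w; rewrite /s_fun /= fct_sumE.
  apply: is_deriveD; first exact/derivableP/diff_derivable.
  apply: is_deriveZ; apply: is_derive_sum => i.
  by apply: is_derive_r_beta => //; exact/derivableP/diff_derivable.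
rewrite derive_val; congr (_ + _); rewrite /GRing.scale /= mulr_sumr.
by apply: eq_bigr => i _; rewrite !mxE mulrDr !mulrA.
Qed.

End PenaltyGradient.

(** * Limits of vectors and normal vectors, and ultrafilters *)

Lemma cvg_rV (R : realType) (m : nat) (T : Type) (F : set_system T) {FF : Filter F}
    (u : T -> 'rV[R]_m) (l : 'rV[R]_m) :
  (forall j, u k 0 j @[k --> F] --> l 0 j) -> u @ F --> l.
Proof.
move=> ul A [P Pl PA].
have : \forall k \near F, forall j, P 0 j (u k 0 j).
  by apply: filter_forall => j; apply: ul; exact: Pl.
by apply: filterS => k Pk; apply: PA => i j; rewrite ord1; exact: Pk.
Qed.

Lemma cvg_coord (R : realType) (m : nat) (T : Type) (F : set_system T) {FF : Filter F}
    (u : T -> 'rV[R]_m) (l : 'rV[R]_m) j :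
  u @ F --> l -> u k 0 j @[k --> F] --> l 0 j.
Proof. by move=> ul A lA; exact: (ul _ (@coord_continuous R 1 m 0 j l A lA)). Qed.

Lemma cvg_sumr (R : realType) (I : Type) (r : seq I) (T : Type) (F : set_system T)
    {FF : Filter F} (g : I -> T -> R) (l : I -> R) :
  (forall i, g i k @[k --> F] --> l i) ->
  \sum_(i <- r) g i k @[k --> F] --> \sum_(i <- r) l i.
Proof. by move=> gl; apply: cvg_big => //; exact: add_continuous. Qed.

(** The normal cone has a closed graph over [C]: for each fixed [c] the defining inequality is
    continuous in the point and the vector jointly. *)
Lemma normal_cone_lim (R : realType) (n : nat) (C : set 'rV[R]_n)
    (T : Type) (F : set_system T) {FF : ProperFilter F} (xs vs : T -> 'rV[R]_n) x v :
  C x -> xs @ F --> x -> vs @ F --> v ->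
  (\forall k \near F, normal_cone C (xs k) (vs k)) -> normal_cone C x v.
Proof.
move=> Cx xsx vsv nc; split=> // c Cc.
apply: (@cvgr_to_le _ F _ _ (fun k => dot (vs k) (c - xs k))).
  apply: cvg_sumr => j.
  rewrite !mxE; under [X in X @ _]eq_fun do rewrite !mxE.
  exact: (cvgM (cvg_coord (j := j) vsv) 
    (cvgB (cvg_cst (c 0 j)) (cvg_coord (j := j) xsx))).
by apply: filterS nc => k [_]; exact.
Qed.

Lemma normal_coneZ (R : realType) (n : nat) (C : set 'rV[R]_n) x v (t : R) :
  0 <= t -> normal_cone C x v -> normal_cone C x (t *: v).
Proof.
move=> t0 [Cx nv]; split=> // c /nv; rewrite /dot.
under [X in _ -> X <= _]eq_bigr do rewrite mxE -mulrA.
by rewrite -mulr_sumr; exact: mulr_ge0_le0.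
Qed.

Lemma ultra_fmap (T V : Type) (U : set_system T) (u : T -> V) :
  UltraFilter U -> UltraFilter (u @ U).
Proof.
move=> UU; split; first exact: fmap_proper_filter.
move=> G PG sUG; apply/seteqP; split=> // A GA.
have [//|nA] := in_ultra_setVsetC (u @^-1` A) UU.
by have [z []] := filter_ex (filterI GA (sUG (~` A) nA)).
Qed.

(** Bolzano-Weierstrass without extracting subsequences: closed balls are compact, so an ultrafilter
    containing one converges. *)
Lemma ultra_bounded_cvg (R : realType) (m : nat) (T : Type) (U : set_system T)
    (u : T -> 'rV[R]_m) (M : R) :
  UltraFilter U -> (\forall k \near U, `|u k| <= M) -> exists l : 'rV[R]_m, u @ U --> l.
Proof.
move=> UU uM.
have : compact [set w : 'rV[R]_m | `|w| <= M].
  apply: bounded_closed_compact.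
    by exists M; split; [exact: num_real|move=> N MN w /= /le_trans; apply; exact: ltW].
  apply: (@closed_comp _ _ (fun w : 'rV[R]_m => `|w|) [set s | s <= M]);
    last exact: closed_le.
  by move=> w _; exact: norm_continuous.
rewrite compact_ultra => /(_ (u @ U) (ultra_fmap u UU) uM) [l [_ ul]].
by exists l.
Qed.

(** * Limits of multipliers under a qualification condition *)

Section MultiplierLimit.
Variables (R : realType) (n p : nat).
Variables (f : 'rV[R]_n -> R) (G H : 'rV[R]_n -> 'rV[R]_p) (C : set 'rV[R]_n).
Hypotheses (f_smooth : smooth f) (G_smooth : forall i, smooth (Gi G i))
  (H_smooth : forall i, smooth (Hi H i)).
Implicit Types (y : 'I_p -> 'rV[R]_2) (u : 'rV[R]_(p + p)).

(** A family of multipliers is packed into one row vector, so that a single norm measures it and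
    compactness applies to the whole family at once. *)
Let enc y : 'rV[R]_(p + p) := row_mx (\row_i y i 0 0) (\row_i y i 0 1).
Let dec u i : 'rV[R]_2 :=
  \row_(j < 2) if j == 0 then u 0 (lshift p i) else u 0 (rshift p i).

Let encK y i : dec (enc y) i = y i.
Proof.
apply/rowP => j; rewrite mxE; case: ifPn => [/eqP ->|j0].
  by rewrite row_mxEl mxE.
rewrite row_mxEr mxE; congr (y i 0 _); apply: val_inj.
by case: j j0 => [[|[|]]].
Qed.

Let dec_eq0 u : (forall i, dec u i = 0) -> u = 0.
Proof.
move=> u0; apply/rowP => j; rewrite mxE; case: (split_ordP j) => i ->.
  by have /rowP/(_ 0) := u0 i; rewrite !mxE.
by have /rowP/(_ 1) := u0 i; rewrite !mxE.
Qed.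

Let decZ (t : R) u i : dec (t *: u) i = t *: dec u i.
Proof. by apply/rowP => j; rewrite !mxE; case: ifP. Qed.

Lemma mult_gradZ (t : R) y x :
  mult_grad G H (fun i => t *: y i) x = t *: mult_grad G H y x.
Proof.
rewrite /mult_grad scaler_sumr; apply: eq_bigr => i _.
by rewrite !mxE scalerDr !scalerA.
Qed.

Lemma mult_grad_cvg (T : Type) (F : set_system T) {FF : Filter F}
    (ys : T -> 'I_p -> 'rV[R]_2) (xs : T -> 'rV[R]_n) y x :
  (forall i, (fun k => ys k i) @ F --> y i) -> xs @ F --> x ->
  (fun k => mult_grad G H (ys k) (xs k)) @ F --> mult_grad G H y x.
Proof.
move=> ysy xsx; apply: cvg_big => [|i _]; first exact: add_continuous.
have Gc := cvg_comp _ _ xsx ((G_smooth i).2 x).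
have Hc := cvg_comp _ _ xsx ((H_smooth i).2 x).
exact: (cvgD (cvgZ (cvg_coord (j := 0) (ysy i)) Gc)
  (cvgZ (cvg_coord (j := 1) (ysy i)) Hc)).
Qed.

Section Limit.
Variables (T : Type) (U : set_system T).
Hypothesis UU : UltraFilter U.
Variables (xs vs : T -> 'rV[R]_n) (x : 'rV[R]_n).
Hypotheses (xs_cvg : xs @ U --> x) (Cx : C x)
  (vs_normal : \forall k \near U, normal_cone C (xs k) (vs k)).

(* If the multipliers are bounded they converge along the ultrafilter;
   otherwise their normalizations converge to a unit multiplier that the
   qualification condition excludes. *)
Lemma multiplier_limit (K : 'I_p -> set 'rV[R]_2) (ys : T -> 'I_p -> 'rV[R]_2) :
  (forall i, closed (K i)) ->
  (forall i (t : R) z, 0 <= t -> K i z -> K i (t *: z)) ->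
  (\forall k \near U, forall i, K i (ys k i)) ->
  (fun k => grad f (xs k) + mult_grad G H (ys k) (xs k) + vs k) @ U --> (0 : 'rV[R]_n) ->
  (forall y, (forall i, K i (y i)) ->
     (exists2 v, normal_cone C x v & mult_grad G H y x + v = 0) ->
     forall i, y i = 0) ->
  exists y, (forall i, K i (y i)) /\
    exists2 v, normal_cone C x v & grad f x + mult_grad G H y x + v = 0.
Proof.
move=> Kcl Kcone ysK res_cvg qc.
have eq_cvgU (a b : T -> 'rV[R]_n) l : a =1 b -> a @ U --> l -> b @ U --> l.
  by move=> /funext ->.
have gradf_cvg : (fun k => grad f (xs k)) @ U --> grad f x.
  exact: (cvg_comp _ _ xs_cvg (f_smooth.2 x)).
have dec_cvg (us : T -> 'rV[R]_(p + p)) l i : us @ U --> l ->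
    (fun k => dec (us k) i) @ U --> dec l i.
  move=> usl; apply: cvg_rV => j; rewrite !mxE.
  by under [X in X @ _]eq_fun do rewrite !mxE; case: ifP => _; exact: cvg_coord.
have K_lim (us : T -> 'rV[R]_(p + p)) l i : us @ U --> l ->
    (\forall k \near U, forall i, K i (dec (us k) i)) -> K i (dec l i).
  move=> /(dec_cvg _ _ i) usl usK; apply: (closed_cvg (K i) (Kcl i) _ _ usl).
  by apply: filterS usK => k; exact.
set us := fun k => enc (ys k).
have usK : \forall k \near U, forall i, K i (dec (us k) i).
  by apply: filterS ysK => k kK i; rewrite encK.
set mg := fun k => mult_grad G H (ys k) (xs k).
have mgE k (t : R) : t *: mg k = mult_grad G H (dec (t *: us k)) (xs k).
  rewrite -mult_gradZ; congr (mult_grad G H _ _); apply/funext => i.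
  by rewrite decZ encK.
have [[M usM]|unbounded] := pselect (exists M : R, \forall k \near U, `|us k| <= M).
  have [l usl] := ultra_bounded_cvg UU usM.
  exists (dec l); split; first by move=> i; exact: K_lim usl usK.
  have mg_cvg : mg @ U --> mult_grad G H (dec l) x.
    rewrite (_ : mg = fun k => mult_grad G H (dec (us k)) (xs k)).
      by apply: mult_grad_cvg => // i; exact: dec_cvg.
    by apply/funext => k; rewrite -[LHS]scale1r mgE scale1r.
  (* This is the limit of [vs], recovered as the residual minus the other two terms. *)
  exists (0 - grad f x - mult_grad G H (dec l) x); last by rewrite sub0r -opprD subrr.
  apply: (normal_cone_lim Cx xs_cvg _ vs_normal).
  apply: eq_cvgU (cvgB (cvgB res_cvg gradf_cvg) mg_cvg) => k.
  by rewrite /mg !fctE [_ + vs k]addrC -addrA -opprD addrK.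
(* For an ultrafilter, failing to be eventually bounded by [M] means eventually exceeding [M]. *)
have us_big (M : R) : \forall k \near U, M < `|us k|.
  have [usM|] := in_ultra_setVsetC [set k | `|us k| <= M] UU.
    by case: unbounded; exists M.
  by apply: filterS => k /= /negP; rewrite -ltNge.
set c := fun k => `|us k|^-1.
have c_cvg : c @ U --> (0 : R).
  apply/cvgr0Pnorm_lt => e e0; apply: filterS (us_big e^-1) => k eu.
  rewrite ger0_norm ?invr_ge0 // -[e]invrK ltf_pV2 ?posrE ?invr_gt0 //.
  by rewrite (lt_trans _ eu) // invr_gt0.
pose ws k := c k *: us k.
have ws1 : \forall k \near U, `|ws k| = 1.
  apply: filterS (us_big 0) => k u0.
  by rewrite normrZ normfV normr_id mulVf // gt_eqF.
have [l wsl] : exists l : 'rV[R]_(p + p), ws @ U --> l.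
  by apply: (@ultra_bounded_cvg _ _ _ _ ws 1 UU); apply: filterS ws1 => k ->.
have l1 : `|l| = 1.
  by apply/eqP; rewrite eq_le; apply/andP; split;
    [apply: (cvgr_to_le (cvg_norm wsl))|apply: (cvgr_to_ge (cvg_norm wsl))];
    apply: filterS ws1 => k ->.
suff l0 : l = 0 by move: l1; rewrite l0 normr0 => /eqP; rewrite eq_sym oner_eq0.
apply: dec_eq0; apply: qc.
  move=> i; apply: K_lim wsl _.
  by apply: filterS usK => k kK j; rewrite decZ; apply: Kcone => //; rewrite invr_ge0.
have mg_cvg : (fun k => c k *: mg k) @ U --> mult_grad G H (dec l) x.
  rewrite (_ : (fun k => _) = fun k => mult_grad G H (dec (ws k)) (xs k)).
    by apply: mult_grad_cvg => // i; exact: dec_cvg.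
  by apply/funext => k; rewrite mgE.
(* This is the limit of [c k *: vs k]: the factor [c] removes the residual and the gradient of [f],
   and the witness keeps the shape given by the limit rules. *)
exists (0 *: (0 - grad f x) - mult_grad G H (dec l) x); last first.
  by rewrite scale0r sub0r subrr.
apply: (normal_cone_lim (vs := fun k => c k *: vs k) Cx xs_cvg); last first.
  by apply: filterS vs_normal => k; apply: normal_coneZ; rewrite invr_ge0.
apply: eq_cvgU (cvgB (cvgZ c_cvg (cvgB res_cvg gradf_cvg)) mg_cvg) => k.
by rewrite /mg !fctE -scalerBr [_ + vs k]addrC -addrA -opprD addrK.
Qed.

End Limit.
End MultiplierLimit.

(** * Closedness and scaling of the complementarity cones *)

Section Cones.
Variable R : realType.
Implicit Types y z : 'rV[R]_2.

(** Independent scaling of the coordinates is stronger than being a cone; it allows a single entry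
    of a multiplier to be replaced by 0. *)
Definition diag_stable (K : set 'rV[R]_2) := forall (s t : R) y, 0 <= s -> 0 <= t ->
  K y -> K (\row_(j < 2) (if j == 0 then s * y 0 0 else t * y 0 1)).

Lemma diag_stableZ (K : set 'rV[R]_2) (t : R) y :
  diag_stable K -> 0 <= t -> K y -> K (t *: y).
Proof.
move=> Kd t0 Ky; rewrite (_ : t *: y =
  \row_(j < 2) (if j == 0 then t * y 0 0 else t * y 0 1)); first exact: Kd.
apply/rowP => j; rewrite !mxE; case: ifPn => [/eqP -> //|j0].
by congr (t * y 0 _); apply: val_inj; case: j j0 => [[|[|]]].
Qed.

Lemma closed_coord_eq0 (j : 'I_2) : closed [set y : 'rV[R]_2 | y 0 j = 0].
Proof.
apply: (@closed_comp _ _ (fun y : 'rV[R]_2 => y 0 j) [set s | s = 0]).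
  by move=> y _; exact: coord_continuous.
exact: closed_eq.
Qed.

Lemma closed_quadrant (c d : R) :
  closed [set y : 'rV[R]_2 | 0 <= c * y 0 0 /\ 0 <= d * y 0 1].
Proof.
have cl (a b : R) : closed [set y : 'rV[R]_2 | 0 <= a * y 0 0 + b * y 0 1].
  exact: closed_halfplane.
have := closedI (cl c 0) (cl 0 d); congr closed; apply/seteqP.
by split => y [] /=; rewrite !mul0r addr0 add0r.
Qed.

Lemma closed_setD2 : closed (@setD2 R).
Proof.
have := closedI (@closed_quadrant 1 1)
  (closedU (@closed_coord_eq0 0) (@closed_coord_eq0 1)).
congr closed; apply/seteqP; split => y /=; rewrite !mul1r.
  by move=> [[y0 y1] [e|e]]; split=> //; rewrite e ?mul0r ?mulr0.
by move=> [y0 y1 /eqP]; rewrite mulf_eq0 => /orP[] /eqP e; do ?split => //; [left|right].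
Qed.

Lemma closed_npos_quadrant : closed [set y : 'rV[R]_2 | y 0 0 <= 0 /\ y 0 1 <= 0].
Proof.
have := @closed_quadrant (-1) (-1); congr closed.
by apply/seteqP; split => y /=; rewrite !mulN1r !oppr_ge0.
Qed.

Lemma closed_nneg_quadrant : closed [set y : 'rV[R]_2 | 0 <= y 0 0 /\ 0 <= y 0 1].
Proof.
have := @closed_quadrant 1 1; congr closed.
by apply/seteqP; split => y /=; rewrite !mul1r.
Qed.

Lemma closed_ND z : setD2 z -> closed (ND z).
Proof.
move=> Dz; rewrite (_ : ND z = if 0 < z 0 0 then [set y : 'rV[R]_2 | y 0 0 = 0] else
    if 0 < z 0 1 then [set y : 'rV[R]_2 | y 0 1 = 0] else
    [set y : 'rV[R]_2 | y 0 0 <= 0 /\ y 0 1 <= 0] `|` @setD2 R).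
  by do 2?case: ifP => _; do ?exact: closed_coord_eq0; apply: closedU;
    [exact: closed_npos_quadrant|exact: closed_setD2].
by rewrite /ND; do 2?case: ifP => _; apply/seteqP; split => y // [].
Qed.

Lemma closed_NDC z : setD2 z -> closed (NDC z).
Proof.
move=> Dz; have [z0|z0] := pselect (z = 0).
  have := closedU (closed_ND Dz) closed_nneg_quadrant; congr closed.
  by apply/seteqP; split => y [|[]]; do ?[by left]; right.
have := closed_ND Dz; congr closed.
by apply/seteqP; split => y; [left|move=> [//|[]]].
Qed.

Lemma diag_stable_ND z : diag_stable (ND z).
Proof.
move=> s t y s0 t0 [Dz Ky]; split=> //; move: Ky; rewrite !mxE /=.
case: ifP => _; first by move=> ->; rewrite mulr0.
case: ifP => _; first by move=> ->; rewrite mulr0.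
move=> [[y0 y1]|[y0 y1 yy]]; [left|right].
  by split; rewrite mulr_ge0_le0.
by split; rewrite !mxE /= ?mulr_ge0 // mulrACA yy mulr0.
Qed.

Lemma diag_stable_NDC z : diag_stable (NDC z).
Proof.
move=> s t y s0 t0 [|[z0 y0 y1]]; first by left; exact: diag_stable_ND.
by right; split => //; rewrite !mxE /= mulr_ge0.
Qed.

End Cones.

(** * Cluster points and constant components *)

(** For each [k] an index beyond [k] is chosen whose term is within [1/(k+1)] of [l]. The bound
    [k <= phi k] stands in for strict monotonicity: it makes [phi] tend to infinity. *)
Lemma cluster_subseq (R : realType) (V : normedModType R) (x : nat -> V) (l : V) :
  cluster (x @ \oo) l ->
  exists2 phi : nat -> nat, (forall k, (k <= phi k)%N) & x \o phi @ \oo --> l.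
Proof.
move=> xl.
have ex k : exists m, (k <= m)%N /\ `|l - x m| < k.+1%:R^-1.
  have xk : (x @ \oo) [set x m | m in [set m | (k <= m)%N]].
    by exists k => // m /= km; exists m.
  have k_gt0 : 0 < k.+1%:R^-1 :> R by rewrite invr_gt0.
  have [_ [[m km <-] lm]] := xl _ _ xk (nbhsx_ballx l _ k_gt0).
  by exists m; split => //; move: lm; rewrite -ball_normE.
have [phi phiP] := choice ex; exists phi => [k|]; first by case: (phiP k).
apply/cvgrPdist_lt => e e0; near=> k.
by rewrite (lt_trans (phiP k).2) //; near: k; exact: near_infty_natSinv_lt (PosNum e0).
Unshelve. all: by end_near. Qed.

Lemma grad_constant (R : realType) (n : nat) (g : 'rV[R]_n -> R) x :
  is_constant g -> grad g x = 0.
Proof.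
move=> [c gc]; apply/rowP => j; rewrite !mxE (_ : g = cst c) ?derive_cst //.
exact/funext.
Qed.

(** * Stationarity of limits of the iterates *)

Section ConvergenceToStationarity.
Variables (R : realType) (n p : nat).
Variables (f : 'rV[R]_n -> R) (G H : 'rV[R]_n -> 'rV[R]_p) (C : set 'rV[R]_n).
Hypotheses (f_smooth : smooth f) (G_smooth : forall i, smooth (Gi G i))
  (H_smooth : forall i, smooth (Hi H i)).

(* Multipliers of constant components are irrelevant and may be unbounded, so
   they are set to zero first. *)
Lemma multiplier_limit_cq (T : Type) (U : set_system T) (UU : UltraFilter U)
    (xs vs : T -> 'rV[R]_n) (x : 'rV[R]_n)
    (K : 'I_p -> set 'rV[R]_2) (ys : T -> 'I_p -> 'rV[R]_2) :
  xs @ U --> x -> C x ->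
  (\forall k \near U, normal_cone C (xs k) (vs k)) ->
  (forall i, closed (K i)) -> (forall i, diag_stable (K i)) ->
  (\forall k \near U, forall i, K i (ys k i)) ->
  (fun k => grad f (xs k) + mult_grad G H (ys k) (xs k) + vs k) @ U --> (0 : 'rV[R]_n) ->
  (forall y, (forall i, K i (y i)) ->
     (exists2 v, normal_cone C x v & mult_grad G H y x + v = 0) ->
     multiplier_trivial G H y) ->
  exists y, (forall i, K i (y i)) /\
    exists2 v, normal_cone C x v & grad f x + mult_grad G H y x + v = 0.
Proof.
move=> xsx Cx vsN Kcl Kdiag ysK res_cvg qc.
(* Inside [K'] a trivial multiplier in the sense of [multiplier_trivial] is zero, which is the form
   of qualification that [multiplier_limit] asks for. *)
pose K' i := K i `&` ([set y : 'rV[R]_2 | is_constant (Gi G i) -> y 0 0 = 0] `&`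
                      [set y : 'rV[R]_2 | is_constant (Hi H i) -> y 0 1 = 0]).
pose sG i : R := (~~ `[< is_constant (Gi G i) >])%:R.
pose sH i : R := (~~ `[< is_constant (Hi H i) >])%:R.
pose ys' k i : 'rV[R]_2 :=
  \row_(j < 2) (if j == 0 then sG i * ys k i 0 0 else sH i * ys k i 0 1).
have sGE i : is_constant (Gi G i) -> sG i = 0 by move=> c; rewrite /sG asboolT.
have sHE i : is_constant (Hi H i) -> sH i = 0 by move=> c; rewrite /sH asboolT.
(* Only entries multiplied by the zero gradient of a constant component were changed. *)
have mgE k : mult_grad G H (ys' k) (xs k) = mult_grad G H (ys k) (xs k).
  apply: eq_bigr => i _; rewrite !mxE /=; congr (_ + _).
    have [c|c] := pselect (is_constant (Gi G i)).
      by rewrite grad_constant // !scaler0.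
    by rewrite /sG asboolF // mul1r.
  have [c|c] := pselect (is_constant (Hi H i)).
    by rewrite grad_constant // !scaler0.
  by rewrite /sH asboolF // mul1r.
have K'cl i : closed (K' i).
  have cl (P : Prop) (j : 'I_2) : closed [set y : 'rV[R]_2 | P -> y 0 j = 0].
    have [hP|nP] := pselect P.
      have := @closed_coord_eq0 R j; congr closed.
      by apply/seteqP; split => y //= /(_ hP).
    by have := @closedT 'rV[R]_2; congr closed; apply/seteqP; split => // y _ /nP.
  by apply: closedI => //; apply: closedI.
have K'Z i (t : R) z : 0 <= t -> K' i z -> K' i (t *: z).
  move=> t0 [Kz [zG zH]]; split; first exact: diag_stableZ.
  by split => /= c; rewrite mxE ?zG ?zH ?mulr0.
have ysK' : \forall k \near U, forall i, K' i (ys' k i).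
  apply: filterS ysK => k kK i; split; first by apply: Kdiag => //; rewrite ler0n.
  by split => /= c; rewrite mxE /= ?sGE ?sHE ?mul0r.
have res_cvg' : (fun k => grad f (xs k) + mult_grad G H (ys' k) (xs k) + vs k)
    @ U --> (0 : 'rV[R]_n).
  by under [X in X @ _]eq_fun do rewrite mgE.
have [|y [yK' stat]] :=
    multiplier_limit f_smooth G_smooth H_smooth UU xsx Cx vsN K'cl K'Z ysK' res_cvg'.
  move=> y yK' sing i.
  have [tG tH] := qc y (fun i => (yK' i).1) sing i.
  have [_ [/= zG zH]] := yK' i.
  apply/rowP => j; rewrite mxE; have [->|j0] := eqVneq j 0; first by case: tG.
  rewrite (_ : j = 1); first by case: tH.
  by apply: val_inj; case: j j0 => [[|[|]]].
by exists y; split => // i; case: (yK' i).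
Qed.

Section Iterates.
Variables (eps lam beta : nat -> R) (x : nat -> 'rV[R]_n).
Hypotheses (x_iterates : homotopy_iterates f G H C eps lam beta x)
  (C_closed : closed C)
  (eps_cvg0 : eps @ \oo --> 0) (lam_cvg0 : lam @ \oo --> 0)
  (sup_beta : sup [set beta k | k in [set k | (0 < k)%N]] < 1)
  (f_bounded_below : has_lbound (range f)).

Let betaP k : (0 < k)%N -> 0 < beta k < 1.
Proof. by case: x_iterates => par _ _ /par[]. Qed.

Let Fi0 i u : Fi G H i u 0 0 = Gi G i u. Proof. by rewrite mxE. Qed.
Let Fi1 i u : Fi G H i u 0 1 = Hi H i u. Proof. by rewrite mxE. Qed.

Lemma beta_gap : exists2 d : R, 0 < d & forall k, (0 < k)%N -> d <= 1 - beta k.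
Proof.
exists (1 - sup [set beta k | k in [set k | (0 < k)%N]]); first by rewrite subr_gt0.
move=> k k0; rewrite lerD2l lerN2; apply: ub_le_sup; last by exists k.
(* The set is bounded above by 1, so its [sup] is a genuine upper bound. *)
by exists 1 => _ [m m0 <-]; have /andP[_ /ltW] := betaP m0.
Qed.

Variables (phi : nat -> nat) (xbar : 'rV[R]_n).
Hypotheses (phi_ge : forall k, (k <= phi k)%N) (x_cvg : x \o phi @ \oo --> xbar).

Let phi_gt0 : \forall k \near \oo, (0 < phi k)%N.
Proof. by exists 1%N => // k /= k1; exact: leq_trans (phi_ge k). Qed.

Let phi_cvg : phi @ \oo --> \oo.
Proof.
move=> A [N _ NA]; exists N => // k /= Nk; apply: NA.
exact: leq_trans (phi_ge k).
Qed.

Let Gi_cvg i : Gi G i (x (phi k)) @[k --> \oo] --> Gi G i xbar.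
Proof. exact: (cvg_comp _ _ x_cvg (differentiable_continuous ((G_smooth i).1 xbar))). Qed.

Let Hi_cvg i : Hi H i (x (phi k)) @[k --> \oo] --> Hi H i xbar.
Proof. exact: (cvg_comp _ _ x_cvg (differentiable_continuous ((H_smooth i).1 xbar))). Qed.

(** If [m] bounds [f] from below, the descent condition bounds the sum of the penalties by
    [lam * (f (x 0) - m)], which tends to 0. So the minimum of the two coordinates vanishes in the
    limit, and this is exactly membership in [setD2]. *)
Lemma cluster_feasible : feasible G H C xbar.
Proof.
have [par x0_feas step] := x_iterates.
split.
  apply: (closed_cvg C C_closed _ _ x_cvg).
  by apply: filterS phi_gt0 => k /step[].
move=> i; have [m fm] := f_bounded_below.
pose mn k := Num.min (Gi G i (x (phi k))) (Hi H i (x (phi k))).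
have min_le : \forall k \near \oo, mn k * mn k <= 2 * (f (x 0%N) - m) * lam (phi k).
  apply: filterS phi_gt0 => k k0.
  have [_ + _] := step _ k0; rewrite le_min /s_fun => /andP[_ sle].
  have [_ lam0 b01] := par _ k0.
  set r := \sum_(_ < _) _ in sle.
  have r_le : r <= lam (phi k) * (f (x 0%N) - m).
    have fmk : m <= f (x (phi k)) by apply: fm; exists (x (phi k)).
    rewrite -(ler_pM2l (_ : 0 < (lam (phi k))^-1)) ?invr_gt0 //.
    rewrite mulrA mulVf ?gt_eqF // mul1r; lra.
  have : r_beta (beta (phi k)) (Fi G H i (x (phi k))) <= r.
    by rewrite /r (bigD1 i) //= lerDl sumr_ge0 // => j _; exact: r_beta_ge0.
  have := le_sqr_min_r_beta (Fi G H i (x (phi k))) b01.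
  by rewrite Fi0 Fi1 expr2 -/(mn k); lra.
have mn_cvg : mn @ \oo --> Num.min (Gi G i xbar) (Hi H i xbar).
  rewrite minr_absE (_ : mn = fun k => (Gi G i (x (phi k)) + Hi H i (x (phi k)) -
      `|Gi G i (x (phi k)) - Hi H i (x (phi k))|) / 2); last first.
    by apply/funext => k; exact: minr_absE.
  exact: (cvgM (cvgB (cvgD (@Gi_cvg i) (@Hi_cvg i))
    (cvg_norm (cvgB (@Gi_cvg i) (@Hi_cvg i)))) (cvg_cst (2^-1 : R))).
have lam_phi : lam (phi k) @[k --> \oo] --> 0 by exact: (cvg_comp _ _ phi_cvg lam_cvg0).
have := ler_cvg_to (cvgM mn_cvg mn_cvg)
  (cvgM (cvg_cst (2 * (f (x 0%N) - m))) lam_phi) min_le.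
rewrite mulr0 -expr2 => min_sqr_le0.
have min0 : Num.min (Gi G i xbar) (Hi H i xbar) = 0.
  by apply/eqP; rewrite -sqrf_eq0 eq_le min_sqr_le0 sqr_ge0.
split; rewrite ?Fi0 ?Fi1.
- by move: min0; case: (leP (Gi G i xbar) (Hi H i xbar)) => [_ -> //|h e]; rewrite -e ltW.
- by move: min0; case: (leP (Gi G i xbar) (Hi H i xbar)) => [h e|_ -> //]; rewrite -e.
- move: min0; case: (leP (Gi G i xbar) (Hi H i xbar)) => _ ->; by rewrite ?mul0r ?mulr0.
Qed.

(** The two clauses of [BCCQ] merged into one cone per index. It reduces to [ND] for a well-behaved
    index, so the same limit argument serves [BCQplus]. *)
Definition limit_cone i : set 'rV[R]_2 :=
  [set y | (well_behaved (Fi G H i) -> ND (Fi G H i xbar) y) /\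
           (~ well_behaved (Fi G H i) -> NDC (Fi G H i xbar) y)].

Definition multiplier k i : 'rV[R]_2 :=
  (lam (phi k))^-1 *: rgrad (beta (phi k)) (Fi G H i (x (phi k))).

Lemma multiplier_limit_cone :
  \forall k \near \oo, forall i, limit_cone i (multiplier k i).
Proof.
apply: filter_forall => i.
have [_ /(_ i)Dz] := cluster_feasible.
have [par _ _] := x_iterates.
have [d d0 dbeta] := beta_gap.
have Gc := @Gi_cvg i; have Hc := @Hi_cvg i.
have lc_ND k : ND (Fi G H i xbar) (multiplier k i) -> limit_cone i (multiplier k i).
  by move=> nd; split => // _; left.
have [G0 H0 GH0] := Dz; rewrite !Fi0 !Fi1 in G0 H0 GH0.
have [Gpos|Gneg] := ltP 0 (Gi G i xbar).
  have HE : Hi H i xbar = 0 by move/eqP: GH0; rewrite mulf_eq0 gt_eqF //= => /eqP.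
  (* Eventually [Hi < d * Gi <= (1 - beta) * Gi], with the uniform gap [d] in place of the varying
     [1 - beta]; this is the cone where the first gradient entry is 0. *)
  have c : d * Gi G i (x (phi k)) - Hi H i (x (phi k)) @[k --> \oo]
      --> d * Gi G i xbar - Hi H i xbar by exact: (cvgB (cvgM (cvg_cst d) Gc) Hc).
  near=> k; apply: lc_ND; split => //.
  have k0 : (0 < phi k)%N by near: k.
  have Gk : 0 < Gi G i (x (phi k)) by near: k; exact: (cvgr_gt _ Gc).
  have Hk : 0 < d * Gi G i (x (phi k)) - Hi H i (x (phi k)).
    by near: k; apply: (cvgr_gt _ c); rewrite HE subr0 mulr_gt0.
  have [_ _ b01] := par _ k0; have db := dbeta _ k0.
  by rewrite Fi0 Gpos mxE rgrad_fst_eq0 ?mulr0 ?Fi0 ?Fi1 ?ltW //; nra.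
have GE : Gi G i xbar = 0 by apply/le_anti/andP.
have [Hpos|Hneg] := ltP 0 (Hi H i xbar).
  have c : d * Hi H i (x (phi k)) - Gi G i (x (phi k)) @[k --> \oo]
      --> d * Hi H i xbar - Gi G i xbar by exact: (cvgB (cvgM (cvg_cst d) Hc) Gc).
  near=> k; apply: lc_ND; split => //.
  have k0 : (0 < phi k)%N by near: k.
  have Hk : 0 < Hi H i (x (phi k)) by near: k; exact: (cvgr_gt _ Hc).
  have Gk : 0 < d * Hi H i (x (phi k)) - Gi G i (x (phi k)).
    by near: k; apply: (cvgr_gt _ c); rewrite GE subr0 mulr_gt0.
  have [_ _ b01] := par _ k0; have db := dbeta _ k0.
  by rewrite Fi0 GE ltxx Fi1 Hpos mxE rgrad_snd_eq0 ?mulr0 ?Fi0 ?Fi1 ?ltW //; nra.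
have HE : Hi H i xbar = 0 by apply/le_anti/andP.
have ND_npos (y : 'rV[R]_2) : y 0 0 <= 0 -> y 0 1 <= 0 -> ND (Fi G H i xbar) y.
  by move=> y0 y1; split => //; rewrite Fi0 Fi1 GE HE ltxx; left.
(* Here [Fi G H i xbar] is the origin. Without good behavior, equal signs suffice, since [NDC] at
   the origin contains both the nonpositive and the nonnegative quadrant. *)
have [[xi xi0 wb]|nwb] := pselect (well_behaved (Fi G H i)); last first.
  apply: filterS phi_gt0 => k k0; split => // _.
  have [_ lam0 b01] := par _ k0.
  have lam1 : 0 <= (lam (phi k))^-1 by rewrite invr_ge0 ltW.
  have [[y0 y1]|[y0 y1]] := rgrad_same_sign (Fi G H i (x (phi k))) b01.
    by left; apply: ND_npos; rewrite mxE mulr_ge0_le0.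
  right; split; [|by rewrite mxE mulr_ge0..].
  by apply/rowP => j; rewrite !mxE; case: ifP.
(* Once the norm is below [xi], good behavior keeps the iterates out of the open positive quadrant,
   and [rgrad_le0] applies. *)
have c : norm2 (Fi G H i (x (phi k))) ^+ 2 @[k --> \oo]
    --> Gi G i xbar * Gi G i xbar + Hi H i xbar * Hi H i xbar.
  rewrite (_ : (fun k => _) = fun k => Gi G i (x (phi k)) * Gi G i (x (phi k))
                                + Hi H i (x (phi k)) * Hi H i (x (phi k))).
    exact: (cvgD (cvgM Gc Gc) (cvgM Hc Hc)).
  by apply/funext => k; rewrite sqr_norm2E Fi0 Fi1 !expr2.
rewrite GE HE mulr0 addr0 in c.
near=> k; apply: lc_ND; have k0 : (0 < phi k)%N by near: k.
have small : norm2 (Fi G H i (x (phi k))) ^+ 2 < xi ^+ 2.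
  by near: k; apply: (cvgr_lt _ c); exact: exprn_gt0.
have [_ lam0 b01] := par _ k0.
  have lam1 : 0 <= (lam (phi k))^-1 by rewrite invr_ge0 ltW.
have [y0 y1] : rgrad (beta (phi k)) (Fi G H i (x (phi k))) 0 0 <= 0 /\
               rgrad (beta (phi k)) (Fi G H i (x (phi k))) 0 1 <= 0.
  apply: rgrad_le0 => // -[p0 p1]; apply: (wb (x (phi k))); split => //.
  by rewrite -(ler_pXn2r (ltn0Sn 1)) ?nnegrE ?sqrtr_ge0 ?ltW.
by apply: ND_npos; rewrite mxE mulr_ge0_le0.
Unshelve. all: by end_near. Qed.

Lemma grad_s_fun_iterate k : (0 < phi k)%N ->
  grad (s_fun f G H (lam (phi k)) (beta (phi k))) (x (phi k)) =
  grad f (x (phi k)) + mult_grad G H (multiplier k) (x (phi k)).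
Proof.
move=> k0; apply: grad_s_fun; first exact: betaP.
- exact: f_smooth.1.
- by move=> i; exact: (G_smooth i).1.
- by move=> i; exact: (H_smooth i).1.
Qed.

(** The distance is an infimum, so a normal vector is chosen strictly within [2 * eps], which
    exceeds the bound [eps] because [eps] is positive. *)
Lemma iterate_residual : exists vs : nat -> 'rV[R]_n,
  (\forall k \near \oo, normal_cone C (x (phi k)) (vs k)) /\
  (fun k => grad f (x (phi k)) + mult_grad G H (multiplier k) (x (phi k)) + vs k)
    @ \oo --> (0 : 'rV[R]_n).
Proof.
have [par _ step] := x_iterates.
have ex k : exists v : 'rV[R]_n, (0 < phi k)%N ->
    normal_cone C (x (phi k)) v /\
    norm2 (- (grad f (x (phi k)) + mult_grad G H (multiplier k) (x (phi k))) - v)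
      < 2 * eps (phi k).
  case: (posnP (phi k)) => [->|k0]; first by exists 0.
  have [_ _ dle] := step _ k0; have [e0 _ _] := par _ k0.
  have : (dist (- grad (s_fun f G H (lam (phi k)) (beta (phi k))) (x (phi k)))
      (normal_cone C (x (phi k))) < (2 * eps (phi k))%:E)%E.
    by apply: le_lt_trans dle _; rewrite lte_fin; lra.
  rewrite grad_s_fun_iterate // => /ereal_inf_lt[_ [v vN <-]]; rewrite lte_fin => vlt.
  by exists v.
have [vs vsP] := choice ex; exists vs; split.
  by apply: filterS phi_gt0 => k /vsP[].
apply: cvg_rV => j; rewrite mxE.
have eps_phi : eps (phi k) @[k --> \oo] --> 0 by exact: (cvg_comp _ _ phi_cvg eps_cvg0).
apply/cvgr0Pnorm_lt => e e0.
near=> k; have k0 : (0 < phi k)%N by near: k.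
have ek : eps (phi k) < e / 2 by near: k; apply: (cvgr_lt _ eps_phi); exact: divr_gt0.
have [_ vlt] := vsP _ k0.
set w := _ + vs k; rewrite (_ : _ - vs k = - w) in vlt; last by rewrite -opprD.
have : `|w 0 j| <= norm2 (- w).
  rewrite -sqrtr_sqr; apply: ler_wsqrtr.
  have -> : w 0 j ^+ 2 = (- w) 0 j * (- w) 0 j by rewrite [(- w) 0 j]mxE mulrNN expr2.
  rewrite /dot (bigD1 j) //= lerDl.
  by apply: sumr_ge0 => l _; rewrite -expr2 sqr_ge0.
move=> /le_lt_trans/(_ vlt)/lt_le_trans; apply; lra.
Unshelve. all: by end_near. Qed.

Let sum_JF y u : \sum_(i < p) y i *m JF G H i u = mult_grad G H y u.
Proof. by apply: sum_JFE => i; [exact: (G_smooth i).1|exact: (H_smooth i).1]. Qed.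

Lemma cluster_stationary :
  (forall y, (forall i, limit_cone i (y i)) ->
     (exists2 v, normal_cone C xbar v & \sum_(i < p) y i *m JF G H i xbar + v = 0) ->
     multiplier_trivial G H y) ->
  exists y, (forall i, limit_cone i (y i)) /\
    exists2 v, normal_cone C xbar v &
      grad f xbar + \sum_(i < p) y i *m JF G H i xbar + v = 0.
Proof.
move=> qc; have [Cx Dx] := cluster_feasible.
(* An ultrafilter finer than [\oo] inherits every limit and every eventual property of the
   iterates. *)
have [U [UU ooU]] := ultraFilterLemma (_ : ProperFilter \oo).
have [vs [/ooU vsN res]] := iterate_residual.
have lcE i : limit_cone i = ND (Fi G H i xbar) \/ limit_cone i = NDC (Fi G H i xbar).
  have [wb|nwb] := pselect (well_behaved (Fi G H i)); [left|right];
    by apply/seteqP; split => [y [lN lC]|y Ky]; [exact: lN || exact: lC|split].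
have lc_closed i : closed (limit_cone i).
  by case: (lcE i) => ->; [exact: closed_ND|exact: closed_NDC].
have lc_diag i : diag_stable (limit_cone i).
  by case: (lcE i) => ->; [exact: diag_stable_ND|exact: diag_stable_NDC].
have := @multiplier_limit_cq _ U UU (x \o phi) vs xbar limit_cone multiplier
  (fun A hA => ooU _ (x_cvg hA)) Cx vsN lc_closed lc_diag
  (ooU _ multiplier_limit_cone) (fun A hA => ooU _ (res A hA)).
under [X in _ -> X]eq_exists do rewrite sum_JF.
apply => y yK; rewrite -sum_JF; exact: qc.
Qed.

Lemma cluster_AM_stationary : (forall i, well_behaved (Fi G H i)) ->
  AM_stationary f G H C xbar.
Proof.
move=> wb; split; first exact: cluster_feasible.
have [_ _ step] := x_iterates.
have [N _ ysN] := multiplier_limit_cone.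
(* AM-stationarity asks for cone membership at every index, so the sequence is shifted past [N]; the
   extra 1 makes [phi (m k)] positive, as the conditions on the iterates require. *)
pose m k := (k + N.+1)%N.
have m_gt0 k : (0 < phi (m k))%N by rewrite (leq_trans _ (phi_ge _)) // /m addnS.
have m_cvg : m @ \oo --> \oo by exact: cvg_addnr.
exists (x \o phi \o m), (multiplier \o m), (fun _ i => Fi G H i xbar); split.
- apply: (@squeeze_cvge _ _ _ _ (cst 0%E) _ (fun k => (eps (phi (m k)))%:E)).
  + apply: nearW => k /=; apply/andP; split.
      by apply: le_ereal_inf_tmp => _ [v _ <-]; rewrite lee_fin sqrtr_ge0.
    have [_ _] := step _ (m_gt0 k).
    by rewrite grad_s_fun_iterate // sum_JF opprD.
  + exact: cvg_cst.
  + apply/fine_cvgP; split; first exact: nearW.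
    exact: (cvg_comp _ _ m_cvg (cvg_comp _ _ phi_cvg eps_cvg0)).
- exact: (cvg_comp _ _ m_cvg x_cvg).
- by move=> i; exact: cvg_cst.
- move=> k i; apply: (ysN (m k) _ i).1 => //=.
  by rewrite /m addnS leqW // leq_addl.
Qed.

End Iterates.
End ConvergenceToStationarity.

(** * The three claims about cluster points *)

Unset Implicit Arguments.

Theorem theorem4p11 (R : realType) (n p : nat)
    (f : 'rV[R]_n -> R) (G H : 'rV[R]_n -> 'rV[R]_p) (C : set 'rV[R]_n)
    (f_smooth : smooth f)
    (G_smooth : forall i, smooth (Gi G i))
    (H_smooth : forall i, smooth (Hi H i))
    (C_nonempty : C !=set0) (C_closed : closed C)
    (C_convex : convex_set (C : set (convex_lmodType 'rV[R]_n)))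
    (solvable : solution_set f G H C !=set0)
    (eps lam beta : nat -> R) (x : nat -> 'rV[R]_n)
    (x_iterates : homotopy_iterates f G H C eps lam beta x)
    (eps_decr : nonincreasing_seq (fun k => eps k.+1))
    (eps_cvg0 : eps @ \oo --> 0)
    (lam_decr : nonincreasing_seq (fun k => lam k.+1))
    (lam_cvg0 : lam @ \oo --> 0)
    (sup_beta : sup [set beta k | k in [set k | (0 < k)%N]] < 1)
    (f_bounded_below : has_lbound (range f)) :
  [/\ forall xbar, cluster (x @ \oo) xbar -> feasible G H C xbar,
      forall xbar, cluster (x @ \oo) xbar -> BCCQ G H C xbar ->
        C_stationary f G H C xbar
    & (forall i, well_behaved (Fi G H i)) ->
      forall xbar, cluster (x @ \oo) xbar ->
        AM_stationary f G H C xbar /\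
        (BCQplus G H C xbar -> M_stationary f G H C xbar)].
Proof.
have cluster_sub xbar : cluster (x @ \oo) xbar -> exists2 phi : nat -> nat,
    (forall k, (k <= phi k)%N) & x \o phi @ \oo --> xbar by exact: cluster_subseq.
split.
- move=> xbar /cluster_sub[phi phi_ge x_cvg].
  exact: (cluster_feasible G_smooth H_smooth x_iterates C_closed lam_cvg0
    f_bounded_below phi_ge x_cvg).
- move=> xbar /cluster_sub[phi phi_ge x_cvg] bccq.
  split; first exact: (cluster_feasible G_smooth H_smooth x_iterates C_closed
    lam_cvg0 f_bounded_below phi_ge x_cvg).
  have [|y [yK stat]] := cluster_stationary f_smooth G_smooth H_smooth x_iterates
    C_closed eps_cvg0 lam_cvg0 sup_beta f_bounded_below phi_ge x_cvg.
    by move=> y yK; apply: bccq => i; [exact: (yK i).1|exact: (yK i).2].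
  exists y; split=> // i.
  have [wb|nwb] := pselect (well_behaved (Fi G H i)); last exact: (yK i).2.
  by left; exact: (yK i).1.
move=> wb xbar /cluster_sub[phi phi_ge x_cvg].
split; first exact: (cluster_AM_stationary f_smooth G_smooth H_smooth x_iterates
  C_closed eps_cvg0 lam_cvg0 sup_beta f_bounded_below phi_ge x_cvg).
move=> bcq.
split; first exact: (cluster_feasible G_smooth H_smooth x_iterates C_closed
  lam_cvg0 f_bounded_below phi_ge x_cvg).
have [|y [yK stat]] := cluster_stationary f_smooth G_smooth H_smooth x_iterates
  C_closed eps_cvg0 lam_cvg0 sup_beta f_bounded_below phi_ge x_cvg.
  by move=> y yK; apply: bcq => i; exact: (yK i).1.
by exists y; split=> // i; exact: (yK i).1.
Qed.
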